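(* Assume (H0) and (H1). In addition, suppose that $H$ is both uniformly convex and semiconcave on $\mathbb{R}^n$, and that $\sigma$ is semiconvex on $\mathbb{R}^n$. Then there is a greatest number $t_*\in(0,T]$ such that the function $u(t,x)=\min_{y\in\mathbb{R}^n}\{\sigma(y)+tH^*(\frac{x-y}{t})\}$ is of class $C^1((0,t_* )\times\mathbb{R}^n)$.
   Context: Let $T>0$, $H:\mathbb{R}^n\to\mathbb{R}$, $\sigma:\mathbb{R}^n\to\mathbb{R}$; $u$ is defined on $\Omega=(0,T)\times\mathbb{R}^n$. $H^*(z)=\max_{y\in\mathbb{R}^n}\{\langle z,y\rangle-H(y)\}$ is the Fenchel conjugate of $H$. (H0): $H$ is strictly convex on $\mathbb{R}^n$ and superlinear, i.e. $\lim_{\|p\|\to\infty}H(p)/\|p\|=+\infty$. (H1): $\sigma$ is continuous on $\mathbb{R}^n$ and for every $(t_0,x_0)\in[0,T)\times\mathbb{R}^n$ there exist constants $r,N>0$ such that $\min_{\|y\|\le N}\{\sigma(y)+tH^*(\frac{x-y}{t})\}<\sigma(z)+tH^*(\frac{x-z}{t})$ whenever $\|z\|>N$, $t\in(0,T)$ and $|t-t_0|+\|x-x_0\|<r$. A continuous function $v:\mathbb{R}^n\to\mathbb{R}$ is semiconcave (with linear modulus) if there is $C>0$ with $\lambda v(y_1)+(1-\lambda)v(y_2)-v(\lambda y_1+(1-\lambda)y_2)\le\lambda(1-\lambda)\frac{C}{2}|y_1-y_2|^2$ for all $y_1,y_2\in\mathbb{R}^n$, $\lambda\in[0,1]$; $v$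 is semiconvex if $-v$ is semiconcave; $v$ is uniformly convex if $v(y)-\Lambda|y|^2$ is convex for some $\Lambda>0$. *)

(* Defs.v *)
From HB Require Import structures.
From mathcomp Require Import all_boot all_order all_algebra.
From mathcomp Require Import all_classical all_reals all_analysis.

Set Implicit Arguments.
Unset Strict Implicit.
Unset Printing Implicit Defensive.

Import Order.TTheory GRing.Theory Num.Theory.
Import numFieldNormedType.Exports.

Local Open Scope classical_set_scope.
Local Open Scope ring_scope.

Section Extrema.
Context {R : realType}.

Definition is_max (A : set R) (m : R) : Prop := A m /\ ubound A m.
Definition is_min (A : set R) (m : R) : Prop := A m /\ lbound A m.

(* Attained extrema of f over A; the value is 0 when f has no maximum
   (minimum) on A, even if its supremum (infimum) is finite. *)
Definition max_over (T : Type) (A : set T) (f : T -> R) : R :=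
  xget 0 [set m | is_max (f @` A) m].
Definition min_over (T : Type) (A : set T) (f : T -> R) : R :=
  xget 0 [set m | is_min (f @` A) m].

End Extrema.

Section Euclidean.
Context {R : realType} {n : nat}.

Definition dotv (x y : 'rV[R]_n) : R := \sum_(i < n) x 0 i * y 0 i.

(* The library norm `|x| on 'rV[R]_n is the sup norm; it induces the same
   topology as the Euclidean norm defined here. *)
Definition enorm (x : 'rV[R]_n) : R := Num.sqrt (dotv x x).

End Euclidean.

Section HopfLax.
Context {R : realType} {n : nat}.
Implicit Types (H sigma v : 'rV[R]_n -> R).

Definition strictly_convex H : Prop :=
  forall (p q : 'rV[R]_n) (l : R), p != q -> 0 < l < 1 ->
    H (l *: p + (1 - l) *: q) < l * H p + (1 - l) * H q.

Definition superlinear H : Prop :=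
  forall M : R, exists K : R,
    forall p : 'rV[R]_n, K < enorm p -> M < H p / enorm p.

Definition semiconcave v : Prop :=
  continuous v /\
  exists2 C : R, 0 < C &
    forall (y1 y2 : 'rV[R]_n) (l : R), 0 <= l <= 1 ->
      l * v y1 + (1 - l) * v y2 - v (l *: y1 + (1 - l) *: y2)
        <= l * (1 - l) * (C / 2) * enorm (y1 - y2) ^+ 2.

Definition semiconvex v : Prop := semiconcave (fun y => - v y).

Definition uniformly_convex v : Prop :=
  exists2 L : R, 0 < L &
    convex_function [set: 'rV[R]_n] (fun y => v y - L * enorm y ^+ 2).

Definition fenchel H (z : 'rV[R]_n) : R :=
  max_over [set: 'rV[R]_n] (fun y => dotv z y - H y).

Definition hopf_cost H sigma (t : R) (x y : 'rV[R]_n) : R :=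
  sigma y + t * fenchel H (t^-1 *: (x - y)).

Definition hopf_lax H sigma (t : R) (x : 'rV[R]_n) : R :=
  min_over [set: 'rV[R]_n] (hopf_cost H sigma t x).

Definition hypH0 H : Prop := strictly_convex H /\ superlinear H.

Definition hypH1 (T : R) H sigma : Prop :=
  continuous sigma /\
  forall (t0 : R) (x0 : 'rV[R]_n), 0 <= t0 < T ->
    exists r N : R, [/\ 0 < r, 0 < N &
      forall (t : R) (x z : 'rV[R]_n),
        N < enorm z -> 0 < t < T -> `|t - t0| + enorm (x - x0) < r ->
        min_over [set y | enorm y <= N] (hopf_cost H sigma t x)
          < hopf_cost H sigma t x z].

End HopfLax.

(* Class C^1 on A, for A open: Frechet differentiable with continuous
   differential.  Continuity of the differential is stated direction by
   direction, which for finite-dimensional V is continuity in operator norm. *)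
Definition C1_on {R : realType} {V : normedModType R} (A : set V) (f : V -> R)
    : Prop :=
  forall p : V, A p ->
    differentiable f p /\
    forall v : V, {for p, continuous (fun q : V => 'd f q v)}.

(* Main.v *)
Require Import Defs.
From HB Require Import structures.
From mathcomp Require Import all_boot all_order all_algebra.
From mathcomp Require Import all_classical all_reals all_analysis.
From mathcomp Require Import ring lra.

Set Implicit Arguments.
Unset Strict Implicit.
Unset Printing Implicit Defensive.

Import Order.TTheory GRing.Theory Num.Theory.
Import numFieldNormedType.Exports.

Local Open Scope classical_set_scope.
Local Open Scope ring_scope.

(** Write G for the conjugate of H and u for the Hopf-Lax function.

    The supremum defining G z is attained, since H is superlinear.  Uniform
    convexity of H makes the maximizer P z depend on z in a Lipschitz way
    (argmax_lipschitz); morally P is the gradient of G.  The function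
    g (t, v) := t G (v / t) is the maximum over q of <v, q> - t H q, a maximum
    of functions linear in (t, v).  Hence g lies above its tangents
    (perspective_tangent), whose slopes (- H (P (v / t)), P (v / t)) are
    continuous in (t, v).

    Semiconcavity of H with constant C turns into strong convexity of G
    (fenchel_strong_tangent).  By scaling, y |-> t G ((x - y) / t) is strongly
    convex with a constant of order 1 / (C t), which for t < 1 / (2 C K)
    outweighs the concavity allowed by the semiconvexity constant K of sigma.
    For such t the cost has a quadratic gap at its minimizer
    (hopf_cost_min_gap), so the minimizer y (t, x) is unique; hypothesis hypH1
    keeps minimizers locally bounded, and together these give its continuity
    in (t, x) (minimizer_continuous).

    Testing the cost at q with the minimizer at p, and the cost at p with the
    minimizer at q, encloses u q - u p between the slopes of g at
    q - (0, y p) and at p - (0, y q), both applied to q - p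
    (hopf_lax_between_slopes).  Both slopes tend to the slope of g at
    p - (0, y p) as q tends to p, so u is differentiable at p with that slope as
    differential, and the differential is continuous because y is.  Thus u is
    C^1 on (0, min (T, 1 / (2 C K))).

    The set of admissible times is therefore nonempty, and it is bounded by T.
    Being C^1 on an open set is a pointwise condition, so it passes to
    increasing unions of time intervals and the supremum of the admissible
    times is itself admissible. *)

(** * Euclidean structure of row vectors *)

Section EuclideanTheory.
Context {R : realType} {n : nat}.
Implicit Types x y z : 'rV[R]_n.

Lemma dotvC x y : dotv x y = dotv y x.
Proof. by apply: eq_bigr => i _; rewrite mulrC. Qed.

Lemma dotvDl x y z : dotv (x + y) z = dotv x z + dotv y z.
Proof. by rewrite -big_split; apply: eq_bigr => i _; rewrite mxE mulrDl. Qed.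

Lemma dotvZl (a : R) x y : dotv (a *: x) y = a * dotv x y.
Proof. by rewrite mulr_sumr; apply: eq_bigr => i _; rewrite mxE mulrA. Qed.

Lemma dotvNl x y : dotv (- x) y = - dotv x y.
Proof. by rewrite -scaleN1r dotvZl mulN1r. Qed.

Lemma dotvDr x y z : dotv z (x + y) = dotv z x + dotv z y.
Proof. by rewrite dotvC dotvDl !(dotvC z). Qed.

Lemma dotvZr (a : R) x y : dotv y (a *: x) = a * dotv y x.
Proof. by rewrite dotvC dotvZl (dotvC y). Qed.

Lemma dotvNr x y : dotv y (- x) = - dotv y x.
Proof. by rewrite dotvC dotvNl (dotvC y). Qed.

Lemma dotv0r x : dotv x 0 = 0.
Proof. by rewrite -(scale0r x) dotvZr mul0r. Qed.

Definition dotvE := (dotvDl, dotvDr, dotvNl, dotvNr, dotvZl, dotvZr).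

Lemma dotv_ge0 x : 0 <= dotv x x.
Proof. by apply: sumr_ge0 => i _; rewrite -expr2 sqr_ge0. Qed.

Lemma sqr_enorm x : enorm x ^+ 2 = dotv x x.
Proof. by rewrite sqr_sqrtr // dotv_ge0. Qed.

Lemma enorm_ge0 x : 0 <= enorm x.
Proof. exact: sqrtr_ge0. Qed.

Lemma enorm0 : enorm (0 : 'rV[R]_n) = 0.
Proof. by rewrite /enorm dotv0r sqrtr0. Qed.

Lemma coord_le_norm x i : `|x 0 i| <= `|x|.
Proof.
rewrite [leRHS]/Num.norm /= mx_normrE.
by apply/bigmax_geP; right => /=; exists (0, i).
Qed.

(** A crude form of Cauchy-Schwarz in the sup norm; it suffices for every
    limit argument below, where constants do not matter. *)
Lemma dotv_norm_le x y : `|dotv x y| <= n%:R * (`|x| * `|y|).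
Proof.
apply: le_trans (ler_norm_sum _ _ _) _.
rewrite -[n in n%:R]card_ord mulr_natl -sumr_const; apply: ler_sum => i _.
by rewrite normrM ler_pM // coord_le_norm.
Qed.

Lemma norm_sqr_le_dotv x : `|x| ^+ 2 <= dotv x x.
Proof.
have [/mx_norm_eq0 ->|/mx_norm_neq0[[i j] /= xE]] := eqVneq (mx_norm x) 0.
  by rewrite normr0 expr0n dotv_ge0.
have -> : `|x| = `|x 0 j| by rewrite -[`|x|]/(mx_norm x) xE ord1.
rewrite real_normK ?num_real // /dotv (bigD1 j) //= -expr2.
by rewrite lerDl sumr_ge0 // => k _; rewrite -expr2 sqr_ge0.
Qed.

Lemma norm_le_enorm x : `|x| <= enorm x.
Proof.
by rewrite -ler_sqr ?nnegrE ?enorm_ge0 // sqr_enorm norm_sqr_le_dotv.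
Qed.

(** Expand 0 <= |c x - y|^2. *)
Lemma dotv_young (c : R) x y : 0 < c ->
  2 * dotv x y <= c * dotv x x + c^-1 * dotv y y.
Proof.
move=> c0; have := dotv_ge0 (c *: x - y).
rewrite !dotvE (dotvC y x) => h.
rewrite -(ler_pM2l c0) mulrDr mulVKf ?gt_eqF //; lra.
Qed.

Lemma dotv_cvg (T : Type) (F : set_system T) {FF : Filter F}
    (f g : T -> 'rV[R]_n) x y :
  f @ F --> x -> g @ F --> y -> dotv (f t) (g t) @[t --> F] --> dotv x y.
Proof.
move=> fx gy; apply: cvg_big => [|i _]; first exact: add_continuous.
have coord z := @coord_continuous R 1 n 0 i z.
exact: cvgM (cvg_comp f _ fx (coord x)) (cvg_comp g _ gy (coord y)).
Qed.

Lemma enorm_continuous : continuous (@enorm R n).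
Proof.
move=> x; have xx : dotv y y @[y --> x] --> dotv x x.
  exact: (@dotv_cvg _ (nbhs x) _ id id).
exact: cvg_comp xx (@sqrt_continuous R (dotv x x)).
Qed.

Lemma compact_enorm_ball (N : R) : compact [set y : 'rV[R]_n | enorm y <= N].
Proof.
apply: bounded_closed_compact.
  exists N; split; first exact: num_real.
  move=> M NM y /= yN; apply: le_trans (norm_le_enorm _) _.
  exact: le_trans yN (ltW NM).
apply: (@closed_comp _ _ (@enorm R n) [set t | t <= N]).
  by move=> x _; exact: enorm_continuous.
exact: closed_le.
Qed.

End EuclideanTheory.

(** * Attained extrema *)

Section AttainedExtrema.
Context {R : realType} {T : Type}.
Implicit Types (A : set T) (f : T -> R).

Lemma max_overE A f a : A a -> (forall b, A b -> f b <= f a) ->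
  max_over A f = f a.
Proof.
move=> Aa fa; apply: xget_unique.
  by split; [exists a | move=> _ [b Ab <-]; exact: fa].
move=> _ [[b Ab <-] fb]; apply/eqP; rewrite eq_le fa //=.
by apply: fb; exists a.
Qed.

Lemma min_overE A f a : A a -> (forall b, A b -> f a <= f b) ->
  min_over A f = f a.
Proof.
move=> Aa fa; apply: xget_unique.
  by split; [exists a | move=> _ [b Ab <-]; exact: fa].
move=> _ [[b Ab <-] fb]; apply/eqP; rewrite eq_le fa // andbT.
by apply: fb; exists a.
Qed.

End AttainedExtrema.

(** * Convexity hypotheses at midpoints *)

Section MidpointInequalities.
Context {R : realType} {n : nat}.
Implicit Types H sigma : 'rV[R]_n -> R.

Definition midpoint (x y : 'rV[R]_n) : 'rV[R]_n := 2^-1 *: (x + y).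

Lemma midpointE (x y : 'rV[R]_n) :
  2^-1 *: x + (1 - 2^-1) *: y = midpoint x y.
Proof. by apply/rowP => i; rewrite !mxE; field. Qed.

Lemma uniformly_convex_midpoint H : uniformly_convex H ->
  exists2 L : R, 0 < L & forall x y : 'rV[R]_n,
    H (midpoint x y) + L / 4 * dotv (x - y) (x - y) <= (H x + H y) / 2.
Proof.
move=> [L L0 cvxH]; exists L => // x y.
have half0 : 0 <= (2^-1 : R) by lra.
have half1 : (2^-1 : R) <= 1 by lra.
have := cvxH (Itv01 half0 half1) x y (in_setT _) (in_setT _).
rewrite convRE /=.
have -> : conv (Itv01 half0 half1) (x : convex_lmodType 'rV[R]_n) y
    = midpoint x y.
  exact: midpointE.
rewrite !sqr_enorm /midpoint /= !dotvE (dotvC y x) => h.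
rewrite /unstable.onem in h; lra.
Qed.

Lemma semiconcave_midpoint H : semiconcave H ->
  exists2 C : R, 0 < C & forall x y : 'rV[R]_n,
    (H x + H y) / 2 <= H (midpoint x y) + C / 8 * dotv (x - y) (x - y).
Proof.
move=> [_ [C C0 scH]]; exists C => // x y.
have half : 0 <= (2^-1 : R) <= 1 by apply/andP; split; lra.
have := scH x y _ half; rewrite midpointE sqr_enorm; lra.
Qed.

End MidpointInequalities.

(** * The Fenchel conjugate and its maximizers *)

Section FenchelConjugate.
Context {R : realType} {n : nat}.
Implicit Types H : 'rV[R]_n -> R.

(** Superlinearity beats the linear term z outside a large ball, where the
    objective falls below its value at 0; inside, compactness applies. *)
Lemma fenchel_argmax H (z : 'rV[R]_n) : continuous H -> superlinear H ->
  exists p, forall y, dotv z y - H y <= dotv z p - H p.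
Proof.
move=> cH slH.
pose M := n%:R * `|z| + 1; have [K HK] := slH M.
(* M exceeds the growth rate of <z, y> by 1, so beyond radius K the objective
   is below - enorm y; this is below - H 0 once enorm y exceeds H 0. *)
pose N := Num.max K (Num.max 0 (H 0)).
have [|||p pN pmax] := @compact_EVT_max _ _ (fun y => dotv z y - H y)
    [set y : 'rV[R]_n | enorm y <= N].
- by exists 0; rewrite /= enorm0 !le_max lexx orbT.
- exact: compact_enorm_ball.
- apply: continuous_subspaceT => y.
  have zy : dotv z t @[t --> y] --> dotv z y.
    exact: (@dotv_cvg R n _ (nbhs y) _ (cst z) id z y (cvg_cst z)
      (@cvg_id _ _)).
  exact: cvgB zy (cH y).
exists p => y; have [yN|yN] := leP (enorm y) N.
  by apply: pmax; rewrite inE.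
have N0 : 0 <= N by rewrite !le_max lexx orbT.
have H0N : H 0 <= N by rewrite !le_max lexx !orbT.
have := pmax 0; rewrite inE /= enorm0 dotv0r => /(_ N0) h0.
have y0 : 0 < enorm y by exact: le_lt_trans yN.
have KN : K <= N by rewrite le_max lexx.
have := HK y (le_lt_trans KN yN); rewrite ltr_pdivlMr // => Hy.
have zy : dotv z y <= n%:R * `|z| * enorm y.
  apply: le_trans (ler_norm _) _; apply: le_trans (dotv_norm_le _ _) _.
  by rewrite -mulrA !ler_wpM2l // norm_le_enorm.
by move: Hy zy; rewrite /M mulrDl mul1r; lra.
Qed.

Section Argmax.
Variables (H : 'rV[R]_n -> R) (P : 'rV[R]_n -> 'rV[R]_n).
Hypothesis argmaxP : forall z y, dotv z y - H y <= dotv z (P z) - H (P z).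

Lemma fenchelE z : fenchel H z = dotv z (P z) - H (P z).
Proof. by apply: (@max_overE _ _ _ (fun y => dotv z y - H y)). Qed.

Lemma fenchel_ge z y : dotv z y - H y <= fenchel H z.
Proof. by rewrite fenchelE. Qed.

(** Comparing the objective for u at P u and at the midpoint of P u and y
    shows that it drops at least quadratically away from P u.  Adding the drop
    for z at P w to the drop for w at P z cancels all values of H and leaves
    L |P w - P z|^2 <= <w - z, P w - P z>. *)
Lemma argmax_lipschitz (L : R) : 0 < L ->
  (forall x y : 'rV[R]_n,
    H (midpoint x y) + L / 4 * dotv (x - y) (x - y) <= (H x + H y) / 2) ->
  forall z w, dotv (P w - P z) (P w - P z) <= L ^- 2 * dotv (w - z) (w - z).
Proof.
move=> L0 cvxH z w.
have gap u y : dotv u y - H y + L / 2 * dotv (y - P u) (y - P u)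
    <= dotv u (P u) - H (P u).
  have := argmaxP u (midpoint y (P u)); have := cvxH y (P u).
  have -> : dotv u (midpoint y (P u)) = 2^-1 * (dotv u y + dotv u (P u)).
    by rewrite dotvZr dotvDr.
  lra.
have symP : dotv (P z - P w) (P z - P w) = dotv (P w - P z) (P w - P z).
  by rewrite -opprB dotvNl dotvNr opprK.
have /(dotv_young (w - z) (P w - P z)) : 0 < L^-1 by rewrite invr_gt0.
have := gap z (P w); have := gap w (P z); rewrite symP invrK.
have -> : dotv (w - z) (P w - P z)
    = dotv w (P w) - dotv w (P z) - dotv z (P w) + dotv z (P z).
  by rewrite !dotvE; ring.
move: (dotv (P w - P z) _) (dotv (w - z) _) => D E gapw gapz young.
have {}young : L * D <= L^-1 * E by lra.
by rewrite -(ler_pM2l L0) (le_trans young) // -exprVn expr2 !mulrA divff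
  ?gt_eqF // mul1r.
Qed.

Lemma argmax_continuous : uniformly_convex H -> continuous P.
Proof.
move=> /uniformly_convex_midpoint[L L0 cvxH].
suff cvgP (z : 'rV[R]_n) : P @ z --> P z by [].
have lipP := argmax_lipschitz L0 cvxH z.
have c0 : dotv (w - z) (w - z) @[w --> z] --> (0 : R).
  have -> : (0 : R) = dotv (z - z) (z - z) by rewrite subrr dotv0r.
  have wz : w - z @[w --> z] --> z - z.
    exact: cvgB (@cvg_id _ (nbhs z)) (cvg_cst z).
  exact: (dotv_cvg wz wz).
have c1 : L ^- 2 * dotv (w - z) (w - z) @[w --> z] --> (0 : R).
  by rewrite -(mulr0 (L ^- 2)); exact: (cvgM (cvg_cst (L ^- 2)) c0).
apply: (proj2 (@cvgrPdist_le _ _ _ (nbhs z) _ P (P z))) => e e0.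
have e20 : 0 < e ^+ 2 by rewrite exprn_gt0.
apply: filterS (proj1 (cvgrPdist_le _ _) c1 _ e20) => w.
rewrite sub0r normrN => we.
rewrite -ler_sqr ?nnegrE ?(ltW e0) // distrC.
apply: le_trans (norm_sqr_le_dotv _) _; apply: le_trans (lipP w) _.
exact: le_trans (ler_norm _) we.
Qed.

(** The vector z is a subgradient of H at P z; semiconcavity at the midpoint of
    P z + s (w - z) and P z - s (w - z) converts this lower bound into the upper
    bound Hy on H along the line.  Testing the conjugate at w with the point
    P z + s (w - z), for the best s = 1 / (2 C), gives the quadratic gain. *)
Lemma fenchel_strong_tangent (C : R) : 0 < C ->
  (forall x y : 'rV[R]_n,
    (H x + H y) / 2 <= H (midpoint x y) + C / 8 * dotv (x - y) (x - y)) ->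
  forall z w, fenchel H z + dotv (w - z) (P z)
      + (4 * C)^-1 * dotv (w - z) (w - z) <= fenchel H w.
Proof.
move=> C0 scH z w.
pose y s := P z + s *: (w - z).
have Hy s : H (y s) <= H (P z) + s * dotv z (w - z)
    + s ^+ 2 * C * dotv (w - z) (w - z).
  have := scH (y s) (y (- s)); have := argmaxP z (y (- s)).
  have -> : midpoint (y s) (y (- s)) = P z.
    by apply/rowP => i; rewrite !mxE; field.
  have -> : y s - y (- s) = (2 * s) *: (w - z).
    by apply/rowP => i; rewrite !mxE; ring.
  have -> : dotv z (y (- s)) = dotv z (P z) - s * dotv z (w - z).
    by rewrite dotvDr dotvZr mulNr.
  rewrite dotvZl dotvZr; lra.
have {}Hy := Hy (2 * C)^-1.
have := fenchel_ge w (y (2 * C)^-1).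
rewrite !fenchelE; move: Hy.
have -> : (2 * C)^-1 ^+ 2 * C = (4 * C)^-1 by field; rewrite gt_eqF.
have -> : (2 * C)^-1 = 2 * (4 * C)^-1 by field; rewrite gt_eqF.
move: (4 * C)^-1 => k.
have -> : dotv w (y (2 * k)) = dotv w (P z) + 2 * k * dotv w (w - z).
  by rewrite dotvDr dotvZr.
have -> : dotv (w - z) (w - z) = dotv w (w - z) - dotv z (w - z).
  by rewrite [LHS]dotvDl dotvNl.
rewrite (dotvDl w) (dotvNl z); lra.
Qed.

End Argmax.

End FenchelConjugate.

(** * Differentiability from converging slopes *)

Section SpaceTime.
Context {R : realType} {n : nat}.
Local Notation V := (R * 'rV[R]_n)%type.
Implicit Types p q s h : V.

Definition bidot s h : R := s.1 * h.1 + dotv s.2 h.2.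

Arguments bidot : simpl never.

Lemma bidotC s h : bidot s h = bidot h s.
Proof. by rewrite /bidot dotvC mulrC. Qed.

Lemma bidotBl s s' h : bidot (s - s') h = bidot s h - bidot s' h.
Proof. by rewrite /bidot /= dotvDl dotvNl; ring. Qed.

Lemma bidotNr s h : bidot s (- h) = - bidot s h.
Proof. by rewrite /bidot /= dotvNr; ring. Qed.

Fact bidot_is_linear s : linear (bidot s : V -> R^o).
Proof.
move=> a h k; rewrite /bidot /= dotvDr dotvZr.
rewrite -[a *: (_ : R^o)]/(a * _) -[a *: h.1]/(a * h.1); ring.
Qed.

HB.instance Definition _ s := @GRing.isLinear.Build R V R^o _ (bidot s)
  (bidot_is_linear s).

Lemma bidot_norm_le s h : `|bidot s h| <= (n%:R + 1) * (`|s| * `|h|).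
Proof.
apply: le_trans (ler_normD _ _) _; rewrite mulrDl mul1r addrC.
have le1 k : `|k.1| <= `|k : V| by rewrite prod_normE le_max lexx.
have le2 k : `|k.2| <= `|k : V| by rewrite prod_normE le_max lexx orbT.
apply: lerD; last by rewrite normrM ler_pM.
apply: le_trans (dotv_norm_le _ _) _.
by apply: ler_wpM2l => //; apply: ler_pM.
Qed.

Lemma bidot_cvg (T : Type) (F : set_system T) {FF : Filter F}
    (f : T -> V) s h :
  f @ F --> s -> bidot (f t) h @[t --> F] --> bidot s h.
Proof.
move=> fs.
have f1 : (f t).1 @[t --> F] --> s.1.
  exact: (cvg_comp _ _ fs cvg_fst).
have f2 : (f t).2 @[t --> F] --> s.2.
  exact: (cvg_comp _ _ fs cvg_snd).
exact: cvgD (cvgM f1 (cvg_cst h.1)) (dotv_cvg f2 (cvg_cst h.2)).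
Qed.

(** An increment enclosed between two slopes that both converge to s equals
    s (q - p) up to an error o (q - p). *)
Lemma differentiable_between_slopes (f : V -> R) (lo up : V -> V) p s :
  lo @ p --> s -> up @ p --> s ->
  (\forall q \near p,
     bidot (lo q) (q - p) <= f q - f p <= bidot (up q) (q - p)) ->
  differentiable f p /\ forall h, 'd f p h = bidot s h.
Proof.
move=> los ups near_f.
have expansion : (f : V -> R^o) \o shift p
      = cst (f p : R^o) + (bidot s : V -> R^o) +o_ (0 : V) (@idfun V).
  apply/eqaddoP => _/posnumP[e].
  pose d := e%:num / (n%:R + 1).
  have n1 : 0 < n%:R + 1 :> R by rewrite ltr_wpDl.
  have d0 : 0 < d by rewrite divr_gt0.
  have near_lo := proj1 (@cvgrPdist_le R V _ _ (nbhs_filter p) lo s) los _ d0.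
  have near_up := proj1 (@cvgrPdist_le R V _ _ (nbhs_filter p) up s) ups _ d0.
  suff : \forall q \near p, `|f q - f p - bidot s (q - p)| <= e%:num * `|q - p|.
    rewrite (near_shift 0 p) => near0; apply: (filterS _ near0) => h /=.
    by rewrite subr0 addrK -addrA -opprD.

  near=> q.
  have slopes s' : `|s - s'| <= d ->
      `|bidot s' (q - p) - bidot s (q - p)| <= e%:num * `|q - p|.
    move=> ss'; rewrite -bidotBl; apply: le_trans (bidot_norm_le _ _) _.
    rewrite distrC mulrA ler_wpM2r // mulrC -ler_pdivlMr //.
  have /slopes : `|s - lo q| <= d by near: q.
  have /slopes : `|s - up q| <= d by near: q.
  have : bidot (lo q) (q - p) <= f q - f p <= bidot (up q) (q - p).
    by near: q.
  by rewrite !ler_norml => /andP[? ?] /andP[? ?] /andP[? ?]; lra.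
have cont_s : continuous (bidot s : V -> R^o).
  suff cvg_s (h : V) : bidot s k @[k --> h] --> bidot s h by [].
  have -> : bidot s = bidot^~ s by apply/funext => k; exact: bidotC.
  exact: (@bidot_cvg _ (nbhs h) (nbhs_filter h) id h s (@cvg_id _ _)).
have df := @diff_unique _ _ _ f (bidot s) p cont_s expansion.
split; last by move=> h; rewrite df.
by apply/diff_locallyP; rewrite df.
Unshelve. all: by end_near. Qed.

End SpaceTime.

(** * The perspective t G (v / t) of the conjugate *)

Section Perspective.
Context {R : realType} {n : nat}.
Local Notation V := (R * 'rV[R]_n)%type.
Variables (H : 'rV[R]_n -> R) (P : 'rV[R]_n -> 'rV[R]_n).
Hypothesis argmaxP : forall z y, dotv z y - H y <= dotv z (P z) - H (P z).
Hypotheses (contH : continuous H) (contP : continuous P).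
Implicit Types p q : V.

Definition perspective p : R := p.1 * fenchel H (p.1^-1 *: p.2).

Definition perspective_slope p : V :=
  (- H (P (p.1^-1 *: p.2)), P (p.1^-1 *: p.2)).

(** The maximizer P (v / t) at p is a competitor in the supremum defining
    the conjugate at q. *)
Lemma perspective_tangent p q : 0 < p.1 -> 0 < q.1 ->
  perspective p + bidot (perspective_slope p) (q - p) <= perspective q.
Proof.
move=> p0 q0; have := fenchel_ge argmaxP (q.1^-1 *: q.2) (P (p.1^-1 *: p.2)).
rewrite -(ler_pM2l q0) -/(perspective q) => /(le_trans _); apply.
rewrite /perspective /bidot (fenchelE argmaxP) /=.
move: (P _) => r; rewrite !dotvZl !mulrBr !mulrA !divff ?gt_eqF // !mul1r.
rewrite dotvDr dotvNr !(dotvC r).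
by rewrite le_eqVlt; apply/orP; left; apply/eqP; ring.
Qed.

Lemma perspective_slope_continuous p : 0 < p.1 ->
  perspective_slope @ p --> perspective_slope p.
Proof.
move=> p0.
have fstp : q.1 @[q --> p] --> p.1 by exact: cvg_fst.
have sndp : q.2 @[q --> p] --> p.2 by exact: cvg_snd.
have ratio : q.1^-1 *: q.2 @[q --> p] --> p.1^-1 *: p.2.
  exact: cvgZ (cvgV (lt0r_neq0 p0) fstp) sndp.
have Pp : P (q.1^-1 *: q.2) @[q --> p] --> P (p.1^-1 *: p.2).
  exact: (cvg_comp _ _ ratio (@contP _)).
have Hp : H (P (q.1^-1 *: q.2)) @[q --> p] --> H (P (p.1^-1 *: p.2)).
  exact: (cvg_comp _ _ Pp (@contH _)).
exact: (cvg_pair (cvgN Hp) Pp).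
Qed.

Lemma fenchel_continuous : continuous (fenchel H).
Proof.
suff fc (z : 'rV[R]_n) : fenchel H w @[w --> z] --> fenchel H z by [].
have -> : fenchel H = fun w => dotv w (P w) - H (P w).
  by apply/funext => w; exact: fenchelE.
have HP : H (P w) @[w --> z] --> H (P z).
  exact: (cvg_comp _ _ (@contP z) (@contH _)).
have zP : dotv w (P w) @[w --> z] --> dotv z (P z).
  exact: (@dotv_cvg _ _ _ (nbhs z) _ id P z (P z) (@cvg_id _ _) (@contP z)).
exact: cvgB zP HP.
Qed.

Lemma hopf_costE sigma t x y :
  hopf_cost H sigma t x y = sigma y + perspective (t, x - y).
Proof. by []. Qed.

Lemma hopf_cost_continuous sigma t x : continuous sigma ->
  continuous (hopf_cost H sigma t x).
Proof.
move=> contS.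
suff cc (y : 'rV[R]_n) :
  hopf_cost H sigma t x w @[w --> y] --> hopf_cost H sigma t x y by [].
have xy : t^-1 *: (x - w) @[w --> y] --> t^-1 *: (x - y).
  exact: cvgZ (cvg_cst _) (cvgB (cvg_cst x) (@cvg_id _ (nbhs y))).
have G : fenchel H (t^-1 *: (x - w)) @[w --> y] --> fenchel H (t^-1 *: (x - y)).
  exact: (cvg_comp _ _ xy (@fenchel_continuous _)).
exact: cvgD (@contS y) (cvgM (cvg_cst t) G).
Qed.

(** At the midpoint m of z and y the conjugate term is below its average by
    at least |z - y|^2 / (16 C t), while sigma exceeds its average by at most
    K / 8 |z - y|^2; minimality of y at m then yields the gap. *)
Lemma hopf_cost_min_gap sigma (C K : R) : 0 < C ->
  (forall x y : 'rV[R]_n,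
    (H x + H y) / 2 <= H (midpoint x y) + C / 8 * dotv (x - y) (x - y)) ->
  (forall x y : 'rV[R]_n,
    sigma (midpoint x y)
      <= (sigma x + sigma y) / 2 + K / 8 * dotv (x - y) (x - y)) ->
  forall t x y, 0 < t ->
  (forall z, hopf_cost H sigma t x y <= hopf_cost H sigma t x z) ->
  forall z, hopf_cost H sigma t x y
      + ((8 * C * t)^-1 - K / 4) * dotv (z - y) (z - y)
    <= hopf_cost H sigma t x z.
Proof.
move=> C0 scH scS t x y t0 ymin z.
pose m := midpoint z y; pose d := z - y.
have := ymin m; have := scS z y; rewrite -/m -/d /hopf_cost.
(* Convexity enters only through the tangent at the midpoint, whose linear
   parts cancel when the inequalities for a = z and a = y are added. *)
have tangent a : fenchel H (t^-1 *: (x - m))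
    + dotv (t^-1 *: (m - a)) (P (t^-1 *: (x - m)))
    + (4 * C)^-1 * dotv (t^-1 *: (m - a)) (t^-1 *: (m - a))
    <= fenchel H (t^-1 *: (x - a)).
  have -> : t^-1 *: (m - a) = t^-1 *: (x - a) - t^-1 *: (x - m).
    by rewrite -scalerBr opprB addrCA addrAC subrr add0r addrC.
  exact: fenchel_strong_tangent.
have := tangent y; have := tangent z.
have -> : m - z = - (2^-1 *: d).
  by apply/rowP => i; rewrite !mxE; field.
have -> : m - y = 2^-1 *: d by apply/rowP => i; rewrite !mxE; field.
rewrite !scalerN !dotvNl !dotvNr opprK !dotvZl !dotvZr.
move: (fenchel H _) (fenchel H _) (fenchel H _) (dotv d _) => Gm Gz Gy.
move: (dotv d d) => D dP hz hy hS hm.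
rewrite -(ler_pM2l t0) in hz; rewrite -(ler_pM2l t0) in hy.
have e1 : t * ((4 * C)^-1 * (t^-1 * (t^-1 * (2^-1 * (2^-1 * D)))))
   = (16 * C * t)^-1 * D.
  by field; rewrite !gt_eqF.
have e2 : (8 * C * t)^-1 = 2 * (16 * C * t)^-1 by field; rewrite !gt_eqF.
rewrite e2; move: (16 * C * t)^-1 e1 e2 => k e1 e2.
lra.
Qed.

End Perspective.

(** * Minimizers of the Hopf-Lax formula *)

Lemma cvg_near_eq (T U : topologicalType) (f g : T -> U) (p : T) :
  (\forall q \near p, f q = g q) -> g @ p --> g p -> f @ p --> f p.
Proof.
move=> near_fg gp; rewrite (nbhs_singleton near_fg).
apply: cvg_trans gp; apply: near_eq_cvg.
by apply: filterS near_fg => q ->.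
Qed.

Section HopfLaxMinimizers.
Context {R : realType} {n : nat}.
Local Notation V := (R * 'rV[R]_n)%type.
Variables (T : R) (H sigma : 'rV[R]_n -> R) (P : 'rV[R]_n -> 'rV[R]_n).
Hypothesis argmaxP : forall z y, dotv z y - H y <= dotv z (P z) - H (P z).
Hypotheses (contH : continuous H) (contP : continuous P).
Hypothesis h1 : hypH1 T H sigma.

Definition hopf_minimizer (t : R) (x y : 'rV[R]_n) :=
  forall z, hopf_cost H sigma t x y <= hopf_cost H sigma t x z.

(** Hypothesis hypH1 rules out competitors outside a ball uniformly near
    (t0, x0); inside the ball the continuous cost attains its minimum. *)
Lemma hopf_minimizer_local t0 x0 : 0 <= t0 < T ->
  exists2 r, 0 < r & exists N : R, forall t x, 0 < t < T ->
    `|t - t0| + enorm (x - x0) < r ->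
    (exists y, hopf_minimizer t x y) /\
    (forall y, hopf_minimizer t x y -> enorm y <= N).
Proof.
move=> t0T; have [contS /(_ t0 x0 t0T)[r [N [r0 N0 outside]]]] := h1.
exists r => //; exists N => t x tT near_x.
have [|||c cN cmin] := @compact_EVT_min _ _ (hopf_cost H sigma t x)
    [set y : 'rV[R]_n | enorm y <= N].
- by exists 0; rewrite /= enorm0 ltW.
- exact: compact_enorm_ball.
- by apply: continuous_subspaceT; exact: hopf_cost_continuous.
rewrite inE /= in cN.
have far z : N < enorm z -> hopf_cost H sigma t x c < hopf_cost H sigma t x z.
  move=> zN; have := outside t x z zN tT near_x.
  by rewrite (@min_overE _ _ _ _ c) // => b bN; apply: cmin; rewrite inE.
split.
  exists c => z; have [zN|/far/ltW //] := leP (enorm z) N.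
  by apply: cmin; rewrite inE.
by move=> y ymin; have [//|/far] := leP (enorm y) N; rewrite ltNge ymin.
Qed.

Variables (C K : R) (Y : V -> 'rV[R]_n).
Hypotheses (C0 : 0 < C) (K0 : 0 < K).
Hypothesis scH : forall x y : 'rV[R]_n,
  (H x + H y) / 2 <= H (midpoint x y) + C / 8 * dotv (x - y) (x - y).
Hypothesis scS : forall x y : 'rV[R]_n,
  sigma (midpoint x y)
    <= (sigma x + sigma y) / 2 + K / 8 * dotv (x - y) (x - y).
Hypothesis minY : forall p : V, 0 < p.1 < T -> hopf_minimizer p.1 p.2 (Y p).
Implicit Types p q : V.

Local Notation slope := (perspective_slope H P).

Lemma hopf_costB p q (y : 'rV[R]_n) : 0 < p.1 -> 0 < q.1 ->
  bidot (slope (p.1, p.2 - y)) (q - p)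
    <= hopf_cost H sigma q.1 q.2 y - hopf_cost H sigma p.1 p.2 y.
Proof.
move=> p0 q0.
have := @perspective_tangent _ _ _ _ argmaxP
  (p.1, p.2 - y) (q.1, q.2 - y) p0 q0.
have -> : (q.1, q.2 - y) - (p.1, p.2 - y) = q - p.
  by congr pair; rewrite /= opprB addrA subrK.
by rewrite !hopf_costE; lra.
Qed.

Lemma near_time (a : R) p : 0 < p.1 < a -> \forall q \near p, 0 < q.1 < a.
Proof.
move=> /andP[p0 pT].
have near0 : \forall q \near p, 0 < q.1.
  exact: (@cvg_fst _ _ _ _ _ _ (lt_nbhsr p0)).
have nearT : \forall q \near p, q.1 < a.
  exact: (@cvg_fst _ _ _ _ _ _ (lt_nbhsl pT)).
by apply: filterS2 near0 nearT => q -> ->.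
Qed.

Lemma near_enorm p (r : R) : 0 < r ->
  \forall q \near p, `|q.1 - p.1| + enorm (q.2 - p.2) < r.
Proof.
move=> r0.
have fstp : `|q.1 - p.1| @[q --> p] --> `|p.1 - p.1|.
  exact: cvg_norm (cvgB (@cvg_fst _ _ _ _ _) (cvg_cst p.1)).
have sndp : enorm (q.2 - p.2) @[q --> p] --> enorm (p.2 - p.2).
  have qp : q.2 - p.2 @[q --> p] --> p.2 - p.2.
    exact: (cvgB (@cvg_snd _ _ _ _ _) (cvg_cst p.2)).
  exact: (cvg_comp _ _ qp (@enorm_continuous _ _ _)).
have sum0 : `|q.1 - p.1| + enorm (q.2 - p.2) @[q --> p] --> (0 : R).
  have -> : (0 : R) = `|p.1 - p.1| + enorm (p.2 - p.2).
    by rewrite !subrr normr0 enorm0 addr0.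
  exact: cvgD fstp sndp.
exact: (sum0 _ (lt_nbhsl r0)).
Qed.

Lemma slope_bounded p (N : R) : 0 < p.1 -> exists2 M, 0 < M &
  forall y : 'rV[R]_n, enorm y <= N -> `|slope (p.1, p.2 - y)| <= M.
Proof.
move=> p0.
have cont : continuous (fun y : 'rV[R]_n => slope (p.1, p.2 - y)).
  suff cy (y : 'rV[R]_n) :
    slope (p.1, p.2 - w) @[w --> y] --> slope (p.1, p.2 - y) by [].
  have py : (p.1, p.2 - w) @[w --> y] --> (p.1, p.2 - y).
    exact: (cvg_pair (cvg_cst p.1) (cvgB (cvg_cst p.2) (@cvg_id _ (nbhs y)))).
  apply: (cvg_comp _ _ py).
  by apply: (@perspective_slope_continuous _ _ H P contH contP (p.1, p.2 - y)).
have /compact_bounded/ex_strict_bound_gt0[M M0 bound] :=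
  continuous_compact (continuous_subspaceT cont) (@compact_enorm_ball R n N).
by exists M => // y yN; apply/ltW/bound; exists y.
Qed.

(** The quadratic gap at p bounds |Y q - Y p|^2 by the difference of the costs
    at p of Y q and Y p.  As Y q is optimal at q, this is at most the sum of the
    variations of the two costs between p and q, each O (|q - p|): for Y q
    because minimizers stay in a ball, for Y p by continuity of the slope. *)
Lemma minimizer_continuous p : 0 < p.1 < T -> p.1 < (2 * C * K)^-1 ->
  Y @ p --> Y p.
Proof.
move=> pT p_small; have /andP[p0 p_lt] := pT.
have [|r r0 [N local]] := @hopf_minimizer_local p.1 p.2.
  by rewrite ltW.
have [M M0 bounded] := slope_bounded N p0.
pose mu := (8 * C * p.1)^-1 - K / 4.
have mu0 : 0 < mu.
  have CK0 : 0 < 2 * C * K by rewrite !mulr_gt0.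
  have Ct0 : 0 < 8 * C * p.1 by rewrite !mulr_gt0.
  move: p_small; rewrite /mu subr_gt0 -[_^-1]mul1r ltr_pdivlMr // => p_small.
  by rewrite -[ltRHS]mul1r ltr_pdivlMr //; lra.
pose M' := `|slope (p.1, p.2 - Y p)| + 1.
have slope_up : slope (q.1, q.2 - Y p) @[q --> p] --> slope (p.1, p.2 - Y p).
  have qY : (q.1, q.2 - Y p) @[q --> p] --> (p.1, p.2 - Y p).
    exact: (cvg_pair (@cvg_fst _ _ _ _ _)
                     (cvgB (@cvg_snd _ _ _ _ _) (cvg_cst (Y p)))).
  apply: (cvg_comp _ _ qY).
  by apply: (@perspective_slope_continuous _ _ _ _ contH contP
               (p.1, p.2 - Y p)).
have near_M' : \forall q \near p, `|slope (q.1, q.2 - Y p)| <= M'.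
  have normM' : `|slope (p.1, p.2 - Y p)| < M' by rewrite ltrDl.
  have cvgM' : `|slope (q.1, q.2 - Y p)| @[q --> p]
      --> `|slope (p.1, p.2 - Y p)| by exact: cvg_norm slope_up.
  by apply: (@filterS _ _ (nbhs_filter p) _ _ _ (cvgM' _ (lt_nbhsl normM')))
    => q /ltW.
pose D := (n%:R + 1) * (M + M') / mu.
have D0 : 0 < D.
  have n1 : 0 < n%:R + 1 :> R by rewrite ltr_wpDl.
  have M'0 : 0 < M' by rewrite ltr_wpDl.
  by rewrite divr_gt0 // mulr_gt0 // addr_gt0.
have lipschitz : \forall q \near p, `|Y q - Y p| ^+ 2 <= D * `|q - p|.
  near=> q.
  have qT : 0 < q.1 < T by near: q; exact: near_time.
  have /andP[q0 _] := qT.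
  have qr : `|q.1 - p.1| + enorm (q.2 - p.2) < r.
    by near: q; exact: near_enorm.
  have YqN : enorm (Y q) <= N.
    by apply: (proj2 (local q.1 q.2 qT qr)); exact: minY.
  have gap := hopf_cost_min_gap argmaxP C0 scH scS p0 (minY pT) (Y q).
  have := minY qT (Y p); have := hopf_costB (Y q) p0 q0.
  have := hopf_costB (Y p) q0 p0.
  have low : `|bidot (slope (p.1, p.2 - Y q)) (q - p)|
      <= (n%:R + 1) * (M * `|q - p|).
    apply: le_trans (bidot_norm_le _ _) _.
    by rewrite ler_wpM2l // ler_wpM2r // bounded.
  have up : `|bidot (slope (q.1, q.2 - Y p)) (p - q)|
      <= (n%:R + 1) * (M' * `|q - p|).
    apply: le_trans (bidot_norm_le _ _) _.
    rewrite [`|p - q|]distrC ler_wpM2l // ler_wpM2r //.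
    by near: q.
  move: low up gap; rewrite !ler_norml -/mu => /andP[? _] /andP[? _] gap.
  move=> hup hlow hmin.
  apply: le_trans (norm_sqr_le_dotv _) _.
  rewrite /D mulrAC ler_pdivlMr // [leLHS]mulrC; lra.
apply: (proj2 (@cvgrPdist_le _ _ _ (nbhs p) (nbhs_filter p) Y (Y p))) => e e0.
have eD : 0 < e ^+ 2 / D by rewrite divr_gt0 // exprn_gt0.
have near_p := proj1 (@cvgrPdist_le _ _ _ _ (nbhs_filter p) id p)
  (@cvg_id _ _) _ eD.
apply: (@filterS2 _ _ (nbhs_filter p) _ _ _ _ lipschitz near_p)
  => q lip_q q_near.
rewrite -ler_sqr ?nnegrE ?(ltW e0) // distrC; apply: le_trans lip_q _.
by rewrite mulrC -ler_pdivlMr // distrC.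
Unshelve. all: by end_near. Qed.


(** * Regularity of the Hopf-Lax function *)

Local Notation u := (fun p : V => hopf_lax H sigma p.1 p.2).

Lemma hopf_laxE p : 0 < p.1 < T ->
  hopf_lax H sigma p.1 p.2 = hopf_cost H sigma p.1 p.2 (Y p).
Proof. by move=> pT; apply: min_overE => // y _; exact: minY. Qed.

(** The minimizer at each endpoint is a competitor at the other one, and the
    cost of a fixed y varies along the tangents of the perspective. *)
Lemma hopf_lax_between_slopes p q : 0 < p.1 < T -> 0 < q.1 < T ->
  bidot (slope (p.1, p.2 - Y q)) (q - p) <= u q - u p
    <= bidot (slope (q.1, q.2 - Y p)) (q - p).
Proof.
move=> pT qT; have /andP[p0 _] := pT; have /andP[q0 _] := qT.
rewrite !hopf_laxE //.
have := minY pT (Y q); have := minY qT (Y p).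
have := hopf_costB (Y q) p0 q0; have := hopf_costB (Y p) q0 p0.
by rewrite -(opprB q p) bidotNr => *; apply/andP; split; lra.
Qed.

Lemma hopf_lax_differentiable p : 0 < p.1 < T -> Y @ p --> Y p ->
  differentiable u p /\ forall h, 'd u p h = bidot (slope (p.1, p.2 - Y p)) h.
Proof.
move=> pT contY; have /andP[p0 _] := pT.
have slope_p := @perspective_slope_continuous _ _ H P contH contP
  (p.1, p.2 - Y p) p0.
have lo : (p.1, p.2 - Y q) @[q --> p] --> (p.1, p.2 - Y p).
  exact: (cvg_pair (cvg_cst p.1) (cvgB (cvg_cst p.2) contY)).
have up : (q.1, q.2 - Y p) @[q --> p] --> (p.1, p.2 - Y p).
  exact: (cvg_pair (@cvg_fst _ _ _ _ _)
                   (cvgB (@cvg_snd _ _ _ _ _) (cvg_cst (Y p)))).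
apply: (differentiable_between_slopes (cvg_comp _ _ lo slope_p)
                                      (cvg_comp _ _ up slope_p)).
apply: (@filterS _ _ (nbhs_filter p) _ _ _ (near_time pT)) => q qT.
exact: hopf_lax_between_slopes.
Qed.

Lemma hopf_lax_C1 (s : R) : s <= T -> s <= (2 * C * K)^-1 ->
  C1_on [set p : V | 0 < p.1 < s] u.
Proof.
move=> sT s_small.
have contY p : 0 < p.1 < s -> Y @ p --> Y p.
  move=> /andP[p0 ps].
  by apply: minimizer_continuous; [rewrite p0 (lt_le_trans ps)
                                  |exact: lt_le_trans s_small].
have inT p : 0 < p.1 < s -> 0 < p.1 < T.
  by move=> /andP[-> ps]; exact: lt_le_trans sT.
suff cont_d (p h : V) : 0 < p.1 < s -> 'd u q h @[q --> p] --> 'd u p h.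
  move=> p ps; split; last by move=> h; exact: cont_d.
  exact: (hopf_lax_differentiable (inT _ ps) (contY _ ps)).1.
move=> ps; have /andP[p0 _] := ps.
have slope_p := @perspective_slope_continuous _ _ H P contH contP
  (p.1, p.2 - Y p) p0.
have qY : (q.1, q.2 - Y q) @[q --> p] --> (p.1, p.2 - Y p).
  exact: (cvg_pair (@cvg_fst _ _ _ _ _)
                   (cvgB (@cvg_snd _ _ _ _ _) (contY _ ps))).
have cvg_d := @bidot_cvg _ _ _ _ (nbhs_filter p) _ _ h
  (cvg_comp _ _ qY slope_p).
have dE q : 0 < q.1 < s -> 'd u q h = bidot (slope (q.1, q.2 - Y q)) h.
  by move=> qs; exact: (hopf_lax_differentiable (inT _ qs) (contY _ qs)).2.
have near_dE : \forall q \near p, 'd u q h = bidot (slope (q.1, q.2 - Y q)) h.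
  exact: (@filterS _ _ (nbhs_filter p) _ _ dE (near_time ps)).
exact: (cvg_near_eq near_dE cvg_d).
Qed.

End HopfLaxMinimizers.


Theorem corollary4p4 (R : realType) (n : nat) (n_gt0 : (0 < n)%N)
    (T : R) (T_gt0 : 0 < T) (H sigma : 'rV[R]_n -> R)
    (h0 : hypH0 H) (h1 : hypH1 T H sigma)
    (H_uconvex : uniformly_convex H) (H_semiconcave : semiconcave H)
    (sigma_semiconvex : semiconvex sigma) :
  exists tstar : R,
    is_max [set s : R | 0 < s <= T /\
              C1_on [set p : R * 'rV[R]_n | 0 < p.1 < s]
                    (fun p : R * 'rV[R]_n => hopf_lax H sigma p.1 p.2)]
           tstar.
Proof.
set S := [set s : R | _].
have contH : continuous H by case: H_semiconcave.
have [P argmaxP] := choice (fun z => fenchel_argmax z contH h0.2).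
have contP := argmax_continuous argmaxP H_uconvex.
have [C C0 scH] := semiconcave_midpoint H_semiconcave.
have [K K0 scNS] := semiconcave_midpoint sigma_semiconvex.
have scS x y : sigma (midpoint x y)
    <= (sigma x + sigma y) / 2 + K / 8 * dotv (x - y) (x - y).
  by have := scNS x y; lra.
have exY (p : R * 'rV[R]_n) :
    exists y, 0 < p.1 < T -> hopf_minimizer H sigma p.1 p.2 y.
  have [pT|?] := pselect (0 < p.1 < T); last by exists 0.
  have [|r r0 [N near_p]] :=
    hopf_minimizer_local argmaxP contH contP h1 (t0 := p.1) p.2.
    by case/andP: pT => /ltW ->.
  have [|[y ymin] _] := near_p p.1 p.2 pT; last by exists y.
  by rewrite !subrr normr0 enorm0 addr0.
have [Y minY] := choice exY.
have S_small : S (Num.min T (2 * C * K)^-1).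
  split; first by rewrite lt_min T_gt0 invr_gt0 !mulr_gt0 //= ge_min lexx.
  apply: (hopf_lax_C1 argmaxP contH contP h1 C0 K0 scH scS minY).
    by rewrite ge_min lexx.
  by rewrite ge_min lexx orbT.
have supS : has_sup S.
  by split; [exists (Num.min T (2 * C * K)^-1) | exists T => s [/andP[]]].
exists (sup S); split; last by move=> s Ss; exact: sup_upper_bound.
split.
  rewrite (lt_le_trans _ (sup_upper_bound supS S_small)) /=; last first.
    by case: S_small => /andP[].
  by apply: ge_sup => [|s [/andP[]]]; first exact: supS.1.
move=> p /andP[p0 p_sup].
(* A point with p.1 < sup S already lies in the slab of some s in S. *)
have [|s Ss ps] := @sup_adherent _ S (sup S - p.1) _ supS.
  by rewrite subr_gt0.
have [_ C1s] := Ss; apply: C1s.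
by rewrite /= p0; move: ps; rewrite opprB addrC subrK.
Qed.
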